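(* (Ghosted Layers is the unconstrained optimum of LinearPatch.) Let $X_{\mathrm{pre}}, X_{\mathrm{post}} \in \mathbb{R}^{T \times C}$ and $\Delta = X_{\mathrm{post}} - X_{\mathrm{pre}}$. Both LinearPatch and Ghosted Layers produce a repaired activation of the form $X_{\mathrm{new}} = X_{\mathrm{pre}} W$, but they differ in the structure of $W$: $$X_{\mathrm{new,LP}} = X_{\mathrm{pre}}\, W_{\mathrm{LP}}, \qquad W_{\mathrm{LP}} = H D H^{\top}, \qquad W_{\mathrm{LP}}^{\top} = W_{\mathrm{LP}},$$ $$X_{\mathrm{new,GL}} = X_{\mathrm{pre}}\, W^{*}, \qquad W^{*} = I + M^{*} \in \mathbb{R}^{C \times C},$$ where $M^{*} = X_{\mathrm{pre}}^{\dagger}\Delta$. The matrix $W^{*} = I + M^{*}$ is the minimum-norm solution to the unconstrained alignment objective $$\min_{W \in \mathbb{R}^{C\times C}} \|X_{\mathrm{pre}}W - X_{\mathrm{post}}\|_F^2,$$ whereas $W_{\mathrm{LP}}$ searches only over symmetric matrices, making LinearPatch a constrained approximation to Ghosted Layers.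
   Context: $T$ and $C$ are positive integers ($T$ is the total number of calibration tokens, $C$ the hidden dimension of a language model). The rows of $X_{\mathrm{pre}}$ and $X_{\mathrm{post}}$ are the hidden states of the original, unpruned model at the $T$ tokens, taken respectively at the input of a block of layers to be removed and at the input of the first layer after that block. $\|\cdot\|_F$ is the Frobenius norm and $I$ is the $C \times C$ identity matrix. $X_{\mathrm{pre}}^{\dagger}$ is the Moore--Penrose pseudoinverse, written as $X_{\mathrm{pre}}^{\dagger} = V\Sigma^{\dagger}U^{\top}$ where $X_{\mathrm{pre}} = U\Sigma V^{\top}$ is the thin singular value decomposition with singular values $\sigma_1 \ge \sigma_2 \ge \cdots$, and $\Sigma^{\dagger}$ is the diagonal matrix with $(\Sigma^{\dagger})_{ii} = 1/\sigma_i$ if $\sigma_i > \epsilon\,\sigma_1$ and $0$ otherwise, with $\epsilon = 10^{-6}$ (a threshold used for numerical stability). ''LinearPatch'' is the recovery method that uses $W = W_{\mathrm{LP}} = HDH^{\top}$, where $H \in \mathbb{R}^{C \times C}$ is the Walsh--Hadamard matrix, satisfying $H^{\top} = H^{-1}$, and $D = \mathrm{diag}(d_1,\dots,d_C)$ is a real diagonal matrix. ''Ghosted Layers'' is the recovery method that uses $W = W^{*} = I + M^{*}$, with no structural constraint on $W^{*}$.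
   Formalization: W* is proved minimum-norm only if X_pre has full column rank (false otherwise: X_pre = 0 gives W* = I); in general W* is a minimizer and M* the least-norm correction. The cutoff ε is assumed to discard no nonzero singular value, else W* need not be a minimizer. *)

(* Defs.v *)
From mathcomp Require Import all_boot all_order all_algebra.
From mathcomp Require Import reals.
Set Implicit Arguments.
Unset Strict Implicit.
Unset Printing Implicit Defensive.
Import Order.TTheory GRing.Theory Num.Theory.
Local Open Scope ring_scope.

Section Definitions.
Variable R : rcfType.

Definition frobenius m n (A : 'M[R]_(m, n)) : R :=
  Num.sqrt (\sum_i \sum_j A i j ^+ 2).

(* The four Penrose equations, which determine Y from A. *)
Definition moore_penrose m n (A : 'M[R]_(m, n)) (Y : 'M[R]_(n, m)) : Prop :=
  [/\ A *m Y *m A = A, Y *m A *m Y = Y,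
      (A *m Y)^T = A *m Y & (Y *m A)^T = Y *m A].

(* The row vector s lists the singular values, zeros included. *)
Definition thin_svd m n (A : 'M[R]_(m, n)) (U : 'M[R]_(m, minn m n))
    (s : 'rV[R]_(minn m n)) (V : 'M[R]_(n, minn m n)) : Prop :=
  [/\ U^T *m U = 1%:M, V^T *m V = 1%:M,
      (forall i, 0 <= s 0 i),
      (forall i j : 'I_(minn m n), (i <= j)%N -> s 0 j <= s 0 i) &
      A = U *m diag_mx s *m V^T].

(* sigma_1; as singular values are nonnegative, the default value 0 of the
   maximum is harmless. *)
Definition sigma_max k (s : 'rV[R]_k) : R := \big[Num.max/0]_i s 0 i.

Definition sigma_dagger (eps : R) k (s : 'rV[R]_k) : 'rV[R]_k :=
  \row_i (if eps * sigma_max s < s 0 i then (s 0 i)^-1 else 0).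

(* V Sigma^dagger U^T with relative cutoff eps. For eps = 0 only the zero
   singular values are dropped; eps = 10^-6 is the usual numerical cutoff. *)
Definition svd_pinv (eps : R) m n k (U : 'M[R]_(m, k)) (s : 'rV[R]_k)
    (V : 'M[R]_(n, k)) : 'M[R]_(n, m) :=
  V *m diag_mx (sigma_dagger eps s) *m U^T.

(* No nonzero singular value is discarded by the cutoff: otherwise svd_pinv
   is the pseudoinverse of a lower-rank matrix. Void when eps = 0. *)
Definition cutoff_harmless (eps : R) k (s : 'rV[R]_k) : Prop :=
  forall i, 0 < s 0 i -> eps * sigma_max s < s 0 i.

Definition repaired T C (Xpre : 'M[R]_(T, C)) (W : 'M[R]_C) : 'M[R]_(T, C) :=
  Xpre *m W.

Definition alignment_loss T C (Xpre Xpost : 'M[R]_(T, C)) (W : 'M[R]_C) : R :=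
  frobenius (repaired Xpre W - Xpost) ^+ 2.

Definition minimizer n (f : 'M[R]_n -> R) (W : 'M[R]_n) : Prop :=
  forall W', f W <= f W'.

(* The strict inequality makes W the only minimizer of least norm. *)
Definition min_norm_minimizer n (f : 'M[R]_n -> R) (W : 'M[R]_n) : Prop :=
  minimizer f W /\
  forall W', minimizer f W' -> W' <> W -> frobenius W < frobenius W'.

(* Orthogonal with all entries +-1/sqrt n. This covers Walsh-Hadamard matrices
   in every row ordering and sign convention (see hadamard_sylvester below),
   and also the orders, not powers of 2, of other Hadamard matrices. *)
Definition hadamard n (H : 'M[R]_n) : Prop :=
  H^T *m H = 1%:M /\ forall i j, `|H i j| = (Num.sqrt n%:R)^-1.

Definition linearpatch_weight n (H : 'M[R]_n) (d : 'rV[R]_n) : 'M[R]_n :=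
  H *m diag_mx d *m H^T.

Definition ghosted_correction T C (Xdag : 'M[R]_(C, T))
    (Xpre Xpost : 'M[R]_(T, C)) : 'M[R]_C :=
  Xdag *m (Xpost - Xpre).

Definition ghosted_weight T C (Xdag : 'M[R]_(C, T))
    (Xpre Xpost : 'M[R]_(T, C)) : 'M[R]_C :=
  1%:M + ghosted_correction Xdag Xpre Xpost.

Lemma expn2S k : (2 ^ k + 2 ^ k = 2 ^ k.+1)%N.
Proof. by rewrite expnS mul2n addnn. Qed.

Fixpoint sylvester k : 'M[R]_(2 ^ k) :=
  if k is k'.+1 then
    let A := sylvester k' in
    castmx (expn2S k', expn2S k')
      ((Num.sqrt 2)^-1 *: block_mx A A A (- A))
  else 1%:M.

Lemma hadamard_sylvester k : hadamard (sylvester k).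
Proof.
have castH m n (e : m = n) (A : 'M[R]_m) : hadamard A -> hadamard (castmx (e, e) A).
  by case: _ / e.
elim: k => [|k [IHo IHe]] /=.
  split=> [|i j]; first by rewrite trmx1 mulmx1.
  by rewrite !ord1 mxE eqxx normr1 sqrtr1 invr1.
have n0 : 0 <= (2 ^ k)%:R :> R by rewrite ler0n.
apply: castH; split=> [|i j].
  have h2 : (Num.sqrt (2 : R))^-1 * (Num.sqrt 2)^-1 * 2 = 1.
    by rewrite -invfM -expr2 sqr_sqrtr ?ler0n // mulVf // pnatr_eq0.
  rewrite [(_ *: _)^T]linearZ /= -scalemxAl -scalemxAr scalerA.
  rewrite tr_block_mx mulmx_block.
  rewrite [(- _)^T]linearN /= !mulmxN !mulNmx opprK IHo subrr.
  rewrite scale_block_mx scaler0 scalar_mx_block -mulr2n -scaler_nat scalerA h2.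
  by rewrite scale1r.
rewrite mxE normrM ger0_norm ?invr_ge0 ?sqrtr_ge0 //.
have -> : (2 ^ k + 2 ^ k)%:R = 2 * (2 ^ k)%:R :> R.
  by rewrite -natrM mul2n addnn.
rewrite sqrtrM ?ler0n // invfM; congr (_ * _).
case: (split_ordP i) => i' ->; case: (split_ordP j) => j' ->.
- by rewrite block_mxEul; exact: IHe.
- by rewrite block_mxEur; exact: IHe.
- by rewrite block_mxEdl; exact: IHe.
- by rewrite block_mxEdr mxE normrN; exact: IHe.
Qed.

End Definitions.

(* Main.v *)
(* With Y the Moore-Penrose inverse of X and W0 = 1 + Y (Z - X), the residual
   X W0 - Z is orthogonal to the column space of X, so by Pythagoras
   ||X W - Z||^2 = ||X (W - W0)||^2 + ||X W0 - Z||^2 for every W. The corrections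
   attaining the minimum are thus Y (Z - X) + N with X N = 0, and the columns of
   Y (Z - X) lie in the range of X^T, orthogonal to those of N, so a second use
   of Pythagoras makes N = 0 the unique choice of least norm. *)
Require Import Defs.
From mathcomp Require Import all_boot all_order all_algebra.
From mathcomp Require Import reals.
Set Implicit Arguments.
Unset Strict Implicit.
Unset Printing Implicit Defensive.
Import Order.TTheory GRing.Theory Num.Theory.
Local Open Scope ring_scope.

Section Frobenius.
Variable R : rcfType.

Lemma frobenius_ge0 m n (A : 'M[R]_(m, n)) : 0 <= frobenius A.
Proof. exact: sqrtr_ge0. Qed.

Lemma frobenius_sqr m n (A : 'M[R]_(m, n)) :
  frobenius A ^+ 2 = \tr (A^T *m A).
Proof.
rewrite sqr_sqrtr; last by do 2![apply: sumr_ge0 => ? _]; exact: sqr_ge0.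
rewrite exchange_big; apply: eq_bigr => j _; rewrite mxE.
by apply: eq_bigr => i _; rewrite mxE expr2.
Qed.

Lemma frobenius_eq0 m n (A : 'M[R]_(m, n)) : frobenius A = 0 -> A = 0.
Proof.
have row_ge0 i : 0 <= \sum_j A i j ^+ 2.
  by apply: sumr_ge0 => j _; exact: sqr_ge0.
move=> /eqP; rewrite sqrtr_eq0 => le0.
have /eqP/psumr_eq0P sum0 : \sum_i \sum_j A i j ^+ 2 == 0.
  by rewrite eq_le le0 sumr_ge0.
apply/matrixP=> i j; apply/eqP; rewrite mxE -sqrf_eq0; apply/eqP.
have /psumr_eq0P row0 := sum0 (fun i _ => row_ge0 i) i isT.
by apply: row0 => // k _; exact: sqr_ge0.
Qed.

(** The cross terms of the trace form of the square are [A^T *m B] and its transpose. Orthogonality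
    of all columns of [A] to all columns of [B] kills both. *)
Lemma frobenius_pythagoras m n (A B : 'M[R]_(m, n)) :
  A^T *m B = 0 -> frobenius (A + B) ^+ 2 = frobenius A ^+ 2 + frobenius B ^+ 2.
Proof.
move=> AB0; have BA0 : B^T *m A = 0 by rewrite -[A]trmxK -trmx_mul AB0 trmx0.
rewrite !frobenius_sqr [(A + B)^T]linearD /= mulmxDl !mulmxDr AB0 BA0.
by rewrite addr0 add0r mxtraceD.
Qed.

End Frobenius.

Section Pseudoinverse.
Variable R : rcfType.

(** Orthonormality of the columns of [U] and [V] cancels the inner factors, so the Penrose equations
    reduce to identities between the diagonal matrices [S] and [E], checked entry by entry. *)
Lemma svd_pinv_moore_penrose (eps : R) m n (A : 'M[R]_(m, n)) U s V :
    thin_svd A U s V -> 0 <= eps -> cutoff_harmless eps s ->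
  moore_penrose A (svd_pinv eps U s V).
Proof.
move=> [UU VV s_ge0 _ ->] eps_ge0 hcut; rewrite /svd_pinv.
set e := sigma_dagger eps s; set S := diag_mx s; set E := diag_mx e.
have max_ge0 : 0 <= sigma_max s by apply: le_trans (bigmax_ge_id _ _ _ _).
have [ses ese] : (forall i, s 0 i * e 0 i * s 0 i = s 0 i) /\
                 (forall i, e 0 i * s 0 i * e 0 i = e 0 i).
  suff H i : s 0 i * e 0 i * s 0 i = s 0 i /\ e 0 i * s 0 i * e 0 i = e 0 i.
    by split=> i; case: (H i).
  rewrite mxE; case: ifPn => [lt_s|].
    have s_neq0 : s 0 i != 0.
      by rewrite gt_eqF // (le_lt_trans _ lt_s) // mulr_ge0.
    by rewrite mulfV // mulVf // !mul1r.
  (* A discarded singular value must be zero: by [hcut], a positive one would have passed the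
     cutoff. *)
  move=> /negP nlt; have -> : s 0 i = 0; last by rewrite !mulr0.
  by apply/eqP; case: eqVneq => // s_neq0; case: nlt; rewrite hcut // lt0r s_neq0 s_ge0.
clearbody e.
have SE : S *m E = E *m S by exact: diag_mxC.
have SES : S *m E *m S = S.
  by rewrite !mulmx_diag; congr diag_mx; apply/rowP => i; rewrite !mxE ses.
have ESE : E *m S *m E = E.
  by rewrite !mulmx_diag; congr diag_mx; apply/rowP => i; rewrite !mxE ese.
have AY : U *m S *m V^T *m (V *m E *m U^T) = U *m (S *m E) *m U^T.
  by rewrite !mulmxA -(mulmxA (U *m S)) VV mulmx1.
have YA : V *m E *m U^T *m (U *m S *m V^T) = V *m (E *m S) *m V^T.
  by rewrite !mulmxA -(mulmxA (V *m E)) UU mulmx1.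
split; rewrite ?AY ?YA.
- by rewrite -!mulmxA (mulmxA U^T) UU mul1mx (mulmxA E) (mulmxA S) (mulmxA S) SES.
- by rewrite -!mulmxA (mulmxA V^T) VV mul1mx (mulmxA S) (mulmxA E) (mulmxA E) ESE.
- by rewrite trmx_mul trmxK trmx_mul (trmx_mul S) !tr_diag_mx -SE mulmxA.
- by rewrite trmx_mul trmxK trmx_mul (trmx_mul E) !tr_diag_mx SE mulmxA.
Qed.

End Pseudoinverse.

Section LeastSquares.
Variables (R : rcfType) (T C : nat) (X Z : 'M[R]_(T, C)) (Y : 'M[R]_(C, T)).
Hypothesis mpY : moore_penrose X Y.

Let M0 := ghosted_correction Y X Z.
Let W0 := ghosted_weight Y X Z.

Lemma alignment_loss_ghosted W :
  alignment_loss X Z W = frobenius (X *m (W - W0)) ^+ 2 + alignment_loss X Z W0.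
Proof.
have [XYX _ XYsym _] := mpY.
rewrite /alignment_loss /repaired -frobenius_pythagoras.
  by rewrite mulmxBr addrA subrK.
rewrite trmx_mul -mulmxA.
suff -> : X^T *m (X *m W0 - Z) = 0 by rewrite mulmx0.
(* Transpose of [X Y X = X], with [X Y] symmetric: [X Y] is the orthogonal projection onto the
   column space of [X]. *)
have XtXY : X^T *m (X *m Y) = X^T by rewrite -XYsym -trmx_mul XYX.
have -> : X *m W0 - Z = X *m Y *m (Z - X) - (Z - X).
  rewrite /W0 /ghosted_weight /ghosted_correction mulmxDr mulmx1 mulmxA.
  by rewrite opprB addrCA addrA.
by rewrite mulmxBr mulmxA XtXY subrr.
Qed.

Lemma ghosted_weight_minimizer : minimizer (alignment_loss X Z) W0.
Proof.
by move=> W; rewrite [leRHS]alignment_loss_ghosted lerDr sqr_ge0.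
Qed.

(** Comparison with [W0] in the Pythagorean decomposition leaves no room for the term in
    [X (W - W0)]. *)
Lemma minimizer_alignment_loss W :
  minimizer (alignment_loss X Z) W -> X *m (W - W0) = 0.
Proof.
move=> /(_ W0); rewrite alignment_loss_ghosted gerDr => le0.
by apply/frobenius_eq0/eqP; rewrite -sqrf_eq0 eq_le le0 sqr_ge0.
Qed.

(** The norm is that of the correction [M], not of [1 + M]: since [W0 = Y Z + (1 - Y X)] and
    [X (1 - Y X) = 0], the weight of least norm is [Y Z], which differs from [W0] unless
    [Y X = 1]. *)
Lemma ghosted_correction_min_norm :
  min_norm_minimizer (fun M => alignment_loss X Z (1%:M + M)) M0.
Proof.
split=> [M|M minM neqM]; first exact: ghosted_weight_minimizer.
have [_ YXY _ YXsym] := mpY.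
have minW : minimizer (alignment_loss X Z) (1%:M + M).
  by move=> W; rewrite -[W](subrKC 1%:M); exact: minM.
have := minimizer_alignment_loss minW.
rewrite /W0 /ghosted_weight -/M0 opprD addrACA subrr add0r => XN0.
(* Symmetry of [Y X] gives [Y^T = Y^T Y X], so [Y^T] kills whatever [X] kills. *)
have YtN0 : Y^T *m (M - M0) = 0.
  by rewrite -YXY trmx_mul YXsym -!mulmxA XN0 !mulmx0.
have M0N0 : M0^T *m (M - M0) = 0 by rewrite trmx_mul -mulmxA YtN0 mulmx0.
rewrite -(@ltr_pXn2r _ 2) ?nnegrE ?frobenius_ge0 // -[M](subrKC M0).
rewrite frobenius_pythagoras // ltrDl lt0r sqr_ge0 andbT sqrf_eq0.
by apply/eqP => /frobenius_eq0/eqP; rewrite subr_eq0 => /eqP.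
Qed.

(** Full column rank makes [X] left-cancellable, so [W0] is the only minimizer and has no competitor
    in norm. *)
Lemma ghosted_weight_min_norm :
  \rank X = C -> min_norm_minimizer (alignment_loss X Z) W0.
Proof.
move=> rkX; split=> [|W /minimizer_alignment_loss XN0 neqW].
  exact: ghosted_weight_minimizer.
have freeXt : row_free X^T by rewrite /row_free mxrank_tr rkX.
case: neqW; apply/eqP; rewrite -subr_eq0 -trmx_eq0 -(mulmx_free_eq0 _ freeXt).
by rewrite -trmx_mul XN0 trmx0.
Qed.

End LeastSquares.

Lemma tr_linearpatch_weight (R : rcfType) n (H : 'M[R]_n) (d : 'rV[R]_n) :
  (linearpatch_weight H d)^T = linearpatch_weight H d.
Proof. by rewrite !trmx_mul trmxK tr_diag_mx mulmxA. Qed.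

Theorem theorem4p1 (R : realType) (T C : nat) (hT : (0 < T)%N) (hC : (0 < C)%N)
    (Xpre Xpost : 'M[R]_(T, C))
    (U : 'M[R]_(T, minn T C)) (s : 'rV[R]_(minn T C)) (V : 'M[R]_(C, minn T C))
    (hsvd : thin_svd Xpre U s V)
    (eps : R) (heps : 0 <= eps) (hcut : cutoff_harmless eps s) :
  let Xdag := svd_pinv eps U s V in
  let Mstar := ghosted_correction Xdag Xpre Xpost in
  let Wstar := ghosted_weight Xdag Xpre Xpost in
  let loss := alignment_loss Xpre Xpost in
  [/\ moore_penrose Xpre Xdag,
      minimizer loss Wstar,
      min_norm_minimizer (fun M => loss (1%:M + M)) Mstar,
      (\rank Xpre = C -> min_norm_minimizer loss Wstar) &
      forall (H : 'M[R]_C) (d : 'rV[R]_C), hadamard H ->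
        let WLP := linearpatch_weight H d in
        WLP^T = WLP /\ loss Wstar <= loss WLP].
Proof.
move=> Xdag Mstar Wstar loss.
have mp : moore_penrose Xpre Xdag by exact: svd_pinv_moore_penrose.
split=> //.
- exact: ghosted_weight_minimizer.
- exact: ghosted_correction_min_norm.
- exact: ghosted_weight_min_norm.
(* [WLP] is one candidate of the unconstrained problem, so the global minimality of [Wstar] bounds
   its loss from below. *)
- move=> H d _ WLP; split; first exact: tr_linearpatch_weight.
  exact: ghosted_weight_minimizer.
Qed.
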